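(* Consider the three-seasonal discrete-time risk model generated by independent random claim amounts $Z_1$, $Z_2$, $Z_3$, and let $S=Z_1+Z_2+Z_3$. If $\mathbb{E}S>3$, then $\psi(u)=1$ for each initial surplus $u\in\mathbb{N}_0$. If $\mathbb{E}S=3$, then we have the following possible cases: \begin{itemize} \item $\psi(0)=\psi(1)=\psi(2)=1$ and $\psi(u)=0$ for $u\in\{3,4,\ldots\}$ if $a_3=b_0=c_0=1$; \item $\psi(0)=\psi(1)=1$ and $\psi(u)=0$ for $u\in\{2,3,\ldots\}$ if $\{a_0=b_3=c_0=1\}$, or $\{a_2=b_1=c_0=1\}$, or $\{a_1=b_2=c_0=1\}$, or $\{a_2=b_0=c_1=1\}$; \item $\psi(0)=1$ and $\psi(u)=0$ for all $u\in\mathbb{N}$ if $\{a_0=b_0=c_3=1\}$, or $\{a_0=b_2=c_1=1\}$, or $\{a_0=b_1=c_2=1\}$, or $\{a_1=b_0=c_2=1\}$, or $\{a_1=b_1=c_1=1\}$; \item $\psi(u)=1$ for all $u\in\mathbb{N}_0$ if $s_3<1$. \end{itemize}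
   Context: $\mathbb{N}_0=\{0,1,2,\ldots\}$, $\mathbb{N}=\{1,2,\ldots\}$. Three-seasonal discrete-time risk model: $Z_1,Z_2,\ldots$ are independent nonnegative integer-valued random variables such that for all $k\in\mathbb{N}_0$, $Z_{3k+1}$ has the same distribution as $Z_1$, $Z_{3k+2}$ has the same distribution as $Z_2$, and $Z_{3k+3}$ has the same distribution as $Z_3$. For initial surplus $u\in\mathbb{N}_0$ the insurer's surplus at time $n\in\mathbb{N}_0$ is $W_u(n)=u+n-\sum_{i=1}^{n}Z_i$. Notation: $a_k=\mathbb{P}(Z_1=k)$, $b_k=\mathbb{P}(Z_2=k)$, $c_k=\mathbb{P}(Z_3=k)$, $s_k=\mathbb{P}(S=k)$ for $k\in\mathbb{N}_0$, where $S=Z_1+Z_2+Z_3$. The ultimate ruin probability is \[ \psi(u)=\mathbb{P}\Biggl(\bigcup_{n=1}^{\infty}\{W_u(n)\leqslant 0\}\Biggr), \] i.e. the probability that the surplus becomes negative or zero at some time $n\in\mathbb{N}$. *)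

(* Defs.v *)
From HB Require Import structures.
From mathcomp Require Import all_boot all_order all_algebra finmap.
From mathcomp Require Import all_classical all_reals all_analysis.

Set Implicit Arguments.
Unset Strict Implicit.
Unset Printing Implicit Defensive.

Import Order.TTheory GRing.Theory Num.Theory.
Import numFieldNormedType.Exports.

Local Open Scope classical_set_scope.
Local Open Scope ring_scope.

Definition mutually_independent (d d' : measure_display)
    (T : measurableType d) (T' : measurableType d') (R : realType)
    (P : probability T R) (I : choiceType) (D : set I)
    (X : I -> {RV P >-> T'}) : Prop :=
  forall (J : {fset I}) (A : I -> set T'),
    [set` J] `<=` D -> (forall i, measurable (A i)) ->
    P (\bigcap_(i in [set` J]) (X i @^-1` A i)) =
    (\prod_(i <- J) P (X i @^-1` A i))%E.

Definition same_distribution (d d' : measure_display)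
    (T : measurableType d) (T' : measurableType d') (R : realType)
    (P : probability T R) (X Y : {RV P >-> T'}) : Prop :=
  forall A : set T', measurable A -> distribution P X A = distribution P Y A.

(* Claims are numbered from 1: [Z n] is the n-th claim for n >= 1, and [Z 0] is
   neither constrained nor used. *)
Record three_seasonal (d : measure_display) (T : measurableType d)
    (R : realType) (P : probability T R) (Z : nat -> {RV P >-> nat}) : Prop := {
  claims_independent : mutually_independent [set n : nat | (0 < n)%N] Z;
  claims_season1 : forall k, same_distribution (Z (3 * k + 1)%N) (Z 1%N);
  claims_season2 : forall k, same_distribution (Z (3 * k + 2)%N) (Z 2%N);
  claims_season3 : forall k, same_distribution (Z (3 * k + 3)%N) (Z 3%N)
}.

Definition surplus (T : Type) (Z : nat -> T -> nat) (u n : nat) (w : T) : int :=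
  u%:Z + n%:Z - \sum_(1 <= i < n.+1) (Z i w)%:Z.

Definition ruin_probability (d : measure_display) (T : measurableType d)
    (R : realType) (P : probability T R) (Z : nat -> T -> nat) (u : nat)
    : \bar R :=
  P (\bigcup_(n in [set n : nat | (1 <= n)%N]) [set w | surplus Z u n w <= 0]).

Definition local_prob (d : measure_display) (T : measurableType d)
    (R : realType) (P : probability T R) (X : T -> nat) (k : nat) : \bar R :=
  P [set w | X w = k].

(* Main.v *)
(** Let p be the law of the block claim S and h(u) the probability, at surplus
    u, that the surplus is positive at the end of every block of three seasons.
    Then h is nondecreasing, h(0) = 0 and h(u) = sum_k p_k h(u + 3 - k) for
    u > 0, with h extended by 0. Summing this identity over 1 <= u <= N
    telescopes; letting N tend to infinity, with L = lim h and
    H(n) = h(1) + ... + h(n), one finds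
      (E S - 3) L + sum_(k < 3) p_k H(3 - k) <= 0
    (for E S replaced by any truncation). If E S > 3 this forces L = 0. If
    E S = 3 and p_3 < 1, then p_k > 0 for some k < 3, so h(1) = 0, and
    harmonicity propagates h = 0 to all u. Finally, s_3 = 1 with independent
    claims forces every claim to be constant. *)

Require Import Defs.
From mathcomp Require Import all_boot all_order all_algebra finmap.
From mathcomp Require Import all_classical all_reals all_analysis.
From mathcomp Require Import zify ring lra.

Set Implicit Arguments.
Unset Strict Implicit.
Unset Printing Implicit Defensive.

Import Order.TTheory GRing.Theory Num.Theory.
Import numFieldNormedType.Exports.

Local Open Scope classical_set_scope.
Local Open Scope ring_scope.

(** * Harmonic functions of the block walk *)

Lemma sum_ord_split (V : nmodType) m n (F : nat -> V) : (m <= n)%N ->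
  \sum_(k < n) F k = \sum_(k < m) F k + \sum_(k < n - m) F (m + k)%N.
Proof. by move=> mn; rewrite -[in LHS](subnKC mn) big_split_ord. Qed.

Section Survival.
Variables (R : realType) (p : nat -> R).
Hypothesis p_ge0 : forall k, 0 <= p k.
Hypothesis p_le1 : forall n, \sum_(k < n) p k <= 1.

(** Transition operator of the walk observed at block ends and killed on leaving the positive
    integers: claims [k >= u + 3] cause ruin and are cut off, and the leading factor kills the walk
    at 0. *)
Definition block_step (f : nat -> R) (u : nat) : R :=
  (0 < u)%N%:R * \sum_(k < u + 3) p k * f (u + 3 - k)%N.

Definition block_survival (n : nat) : nat -> R :=
  iter n block_step (fun u => (0 < u)%N%:R).

Lemma block_step0 f : block_step f 0 = 0.
Proof. by rewrite /block_step mul0r. Qed.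

Lemma block_step_le f g : (forall u, f u <= g u) ->
  forall u, block_step f u <= block_step g u.
Proof.
move=> fg u; apply: ler_wpM2l => //; apply: ler_sum => k _.
exact: ler_wpM2l.
Qed.

Lemma block_step_nondecreasing f : (forall u, 0 <= f u) ->
  {homo f : u v / (u <= v)%N >-> u <= v} ->
  {homo block_step f : u v / (u <= v)%N >-> u <= v}.
Proof.
move=> f0 fm [|u] [|v]//; rewrite /block_step ?mul0r ?mul1r//.
  by move=> _; apply: sumr_ge0 => k _; apply: mulr_ge0.
move=> uv.
rewrite [leRHS](sum_ord_split (fun k => p k * f (v.+1 + 3 - k)%N)
  (leq_add uv (leqnn 3))).
rewrite -[leLHS]addr0; apply: lerD; last first.
  by apply: sumr_ge0 => k _; apply: mulr_ge0.
by apply: ler_sum => k _; apply: ler_wpM2l => //; apply: fm; lia.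
Qed.

Lemma block_survival_at0 n : block_survival n 0 = 0.
Proof. by case: n => [|n]//; rewrite /block_survival iterS block_step0. Qed.

Lemma block_survival_ge0 n u : 0 <= block_survival n u.
Proof.
elim: n u => [|n IH] u; first exact: ler0n.
apply: mulr_ge0; first exact: ler0n.
by apply: sumr_ge0 => k _; apply: mulr_ge0.
Qed.

(** The first step loses mass because [p] sums to at most 1; monotonicity of [block_step] propagates
    the inequality. *)
Lemma block_survivalS_le n u :
  block_survival n.+1 u <= block_survival n u.
Proof.
elim: n u => [|n IH] u; last exact: block_step_le.
rewrite /block_survival/= /block_step ler_piMr//.
apply: le_trans (p_le1 (u + 3)); apply: ler_sum => k _.
by rewrite ler_piMr//; case: (_ < _)%N.
Qed.

Lemma block_survival_nondecreasing n :
  {homo block_survival n : u v / (u <= v)%N >-> u <= v}.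
Proof.
elim: n => [|n IH].
  by move=> u v uv; rewrite /block_survival/= ler_nat; lia.
exact: block_step_nondecreasing (block_survival_ge0 n) IH.
Qed.

Lemma block_survival_nonincreasing u :
  nonincreasing_seq (fun n => block_survival n u).
Proof. by apply/nonincreasing_seqP => n; exact: block_survivalS_le. Qed.

Lemma block_survival_cvg u : cvgn (fun n => block_survival n u).
Proof.
apply: nonincreasing_is_cvgn; first exact: block_survival_nonincreasing.
by exists 0 => _ [n _ <-]; exact: block_survival_ge0.
Qed.

Section HarmonicFunction.
Variable h : nat -> R.
Hypothesis h0 : h 0 = 0.
Hypothesis h_mono : {homo h : u v / (u <= v)%N >-> u <= v}.
Hypothesis h_harm : forall u, h u = block_step h u.

Let h_ge0 u : 0 <= h u.
Proof. by rewrite -h0; exact: h_mono. Qed.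

Let H n := \sum_(v < n) h v.+1.

Let H_ge0 n : 0 <= H n. Proof. exact: sumr_ge0. Qed.

Let H_cat m n : H (m + n) = H m + \sum_(v < n) h (m + v).+1.
Proof. by rewrite /H big_split_ord. Qed.

(** The shifted window is [H (N + j) - H j], and the [j] terms past [N] are each at most [L]. *)
Let shift_up (L : R) N j : (forall u, h u <= L) ->
  \sum_(u < N) h (u.+1 + j)%N <= H N + j%:R * L - H j.
Proof.
move=> hL.
rewrite lerBrDl (eq_bigr (fun u : 'I_N => h (j + u).+1)); last first.
  by move=> u _; congr h; lia.
rewrite -H_cat addnC H_cat lerD2l mulr_natl.
rewrite -[X in _ *+ X](card_ord j) -sumr_const.
exact: ler_sum.
Qed.

(** The window loses its top [j] terms, each at least [h (N - j)] by monotonicity; indices truncated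
    to 0 contribute [h 0 = 0]. *)
Let shift_down N j :
  \sum_(u < N) h (u.+1 - j)%N <= H N - j%:R * h (N - j)%N.
Proof.
have [jN|Nj] := leqP j N; last first.
  have -> : (N - j = 0)%N by lia.
  by rewrite h0 mulr0 subr0; apply: ler_sum => u _; apply: h_mono; lia.
have -> : \sum_(u < N) h (u.+1 - j)%N = H (N - j).
  rewrite (sum_ord_split (fun u => h (u.+1 - j)%N) jN) big1 ?add0r.
    by apply: eq_bigr => u _; congr h; lia.
  by move=> i _; rewrite (_ : (_ - _ = 0)%N)//; have := ltn_ord i; lia.
rewrite lerBrDr -[in leRHS](subnK jN) H_cat lerD2l mulr_natl.
rewrite -[X in _ *+ X](card_ord j) -sumr_const.
by apply: ler_sum => u _; apply: h_mono; lia.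
Qed.

Let H_harm N : H N = \sum_(k < N + 3) p k * \sum_(u < N) h (u.+1 + 3 - k)%N.
Proof.
rewrite /H.
transitivity (\sum_(u < N) \sum_(k < N + 3) p k * h (u.+1 + 3 - k)%N).
  apply: eq_bigr => u _; rewrite h_harm /block_step mul1r.
  (* The range of [k] is enlarged to one independent of [u], so that the sums can be exchanged; the
     added indices truncate to 0, where [h] vanishes. *)
  have uN : (u.+1 + 3 <= N + 3)%N by have := ltn_ord u; lia.
  rewrite [RHS](sum_ord_split (fun k => p k * h (u.+1 + 3 - k)%N) uN).
  rewrite [X in _ + X]big1 ?addr0//.
  by move=> i _; have -> : (u.+1 + 3 - (u.+1 + 3 + i) = 0)%N; rewrite ?h0 ?mulr0//; lia.
by rewrite exchange_big/=; apply: eq_bigr => k _; rewrite mulr_sumr.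
Qed.

(** Since [p] has mass at most 1, [H_harm] bounds by 0 the [p]-weighted sum of the differences
    between [H N] and its shifted windows. Claims below 3 are estimated by [shift_up], the next [J]
    values by [shift_down], and the nonnegative remainder is dropped. *)
Lemma drift_limit_le0 (J : nat) (L : R) : h @ \oo --> L ->
  (\sum_(k < 3 + J) (k%:R - 3) * p k) * L + \sum_(k < 3) p k * H (3 - k) <= 0.
Proof.
move=> hcvg.
have hL u : h u <= L.
  rewrite -(cvg_lim (@Rhausdorff R) hcvg); apply: nondecreasing_cvgn_le => //.
  by apply/cvg_ex; exists L.
have key t : \sum_(k < 3) p k * (H (3 - k) - (3 - k)%:R * L) +
    (\sum_(j < J) j%:R * p (3 + j)%N) * h t <= 0.
  (* With this [N], every [j < J] satisfies [t <= N - j], so all the lower bounds involve the single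
     value [h t], which tends to [L]. *)
  set N := (J + t)%N.
  have N3 : (3 + J <= N + 3)%N by rewrite /N; lia.
  have : \sum_(k < N + 3) p k * (H N - \sum_(u < N) h (u.+1 + 3 - k)%N) <= 0.
    under eq_bigr do rewrite mulrBr.
    by rewrite sumrB -H_harm -mulr_suml subr_le0 ler_piMl.
  apply: le_trans.
  rewrite (sum_ord_split
    (fun k => p k * (H N - \sum_(u < N) h (u.+1 + 3 - k)%N)) N3) !big_split_ord/= -[leLHS]addr0.
  apply: lerD; first apply: lerD.
  - apply: ler_sum => k _; apply: ler_wpM2l => //.
    have -> : \sum_(u < N) h (u.+1 + 3 - k)%N = \sum_(u < N) h (u.+1 + (3 - k))%N.
      by apply: eq_bigr => u _; rewrite addnBA// ltnW.
    have := @shift_up L N (3 - k)%N hL; lra.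
  - rewrite mulr_suml; apply: ler_sum => j _.
    rewrite mulrAC [X in X <= _]mulrC; apply: ler_wpM2l => //.
    have -> : \sum_(u < N) h (u.+1 + 3 - (3 + j))%N = \sum_(u < N) h (u.+1 - j)%N.
      by apply: eq_bigr => u _; rewrite [(3 + j)%N]addnC subnDr.
    have := @shift_down N j.
    have : j%:R * h t <= j%:R * h (N - j)%N.
      by apply: ler_wpM2l => //; apply: h_mono; have := ltn_ord j; rewrite /N; lia.
    lra.
  - apply: sumr_ge0 => k _; apply: mulr_ge0 => //; rewrite subr_ge0.
    by apply: ler_sum => u _; apply: h_mono; lia.
rewrite big_split_ord/=.
have -> : \sum_(j < J) ((3 + j)%N%:R - 3) * p (3 + j)%N =
    \sum_(j < J) j%:R * p (3 + j)%N.
  by apply: eq_bigr => j _; rewrite natrD addrAC subrr add0r.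
set A := \sum_(j < J) _ in key *.
suff : \sum_(k < 3) p k * (H (3 - k) - (3 - k)%:R * L) + A * L <= 0.
  rewrite mulrDl addrAC.
  congr (_ + _ <= 0); rewrite mulr_suml -big_split; apply: eq_bigr => k _ /=.
  by rewrite (natrB _ (ltnW (ltn_ord k))); ring.
apply: (cvgr_to_le (F := \oo) (f := fun t => \sum_(k < 3) p k * (H (3 - k) - (3 - k)%:R * L) + A * h t)).
  by apply: cvgD; [exact: cvg_cst | apply: cvgM; [exact: cvg_cst | exact: hcvg]].
by apply: nearW => t; exact: key.
Qed.

Lemma harmonic_eq0 : (forall u, h u <= 1) ->
  (exists J, 0 < \sum_(k < 3 + J) (k%:R - 3) * p k) \/
  (forall e, 0 < e -> exists J, - e < \sum_(k < 3 + J) (k%:R - 3) * p k) /\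
    (exists2 k, (k < 3)%N & 0 < p k) ->
  forall u, h u = 0.
Proof.
move=> h1 drift.
have hcvg : cvgn h by apply: nondecreasing_is_cvgn => //; exists 1 => _ [u _ <-].
have hL u : h u <= limn h by exact: nondecreasing_cvgn_le.
have L0 : 0 <= limn h by apply: le_trans (hL 0); rewrite h0.
have L1 : limn h <= 1 by apply: limr_le => //; apply: nearW => u; exact: h1.
have := drift_limit_le0 _ hcvg.
set L := limn h in hL L0 L1 *; set c := \sum_(k < 3) _ => key.
have c0 : 0 <= c by apply: sumr_ge0 => k _; apply: mulr_ge0.
case: drift => [[J MJ]|[small [k k3 pk]]] u.
  apply/eqP; rewrite eq_le h_ge0 andbT (le_trans (hL u))//.
  by rewrite -(ler_pM2l MJ) mulr0; apply: le_trans (key J); rewrite lerDl.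
have {}c0 : c = 0.
  apply/eqP; rewrite eq_le c0 andbT leNgt; apply/negP => {}c0.
  (* As [L <= 1], a drift above [- c / 2] would turn [M * L + c <= 0] into [c <= c / 2]. *)
  have c2 : 0 < c / 2 by rewrite divr_gt0.
  have [J MJ] := small _ c2; have := key J; move: MJ.
  set M := \sum_(k < _) _ => MJ MLc.
  have : - (c / 2) * L <= M * L by apply: ler_wpM2r => //; exact: ltW.
  have : c / 2 * L <= c / 2 by apply: ler_piMr => //; exact: ltW.
  by lra.
have h1_0 : h 1 = 0.
  apply/eqP; rewrite eq_le h_ge0 andbT -(ler_pM2l pk) mulr0 -c0.
  rewrite /c (bigD1 (Ordinal k3))//= -[leLHS]addr0; apply: lerD; last first.
    by apply: sumr_ge0 => j _; apply: mulr_ge0.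
  apply: ler_wpM2l => //; rewrite /H -(@subnSK k 3)// big_ord_recl.
  by rewrite lerDl; apply: sumr_ge0.
(* A block claim [k < 3] raises the surplus by at least 1, so harmonicity at [n.+1] gives
   [p k * h n.+2 <= h n.+1 = 0]. *)
case: u => // n; elim: n => [//|n IH].
apply/eqP; rewrite eq_le h_ge0 andbT -(ler_pM2l pk) mulr0 -IH [leRHS]h_harm.
rewrite /block_step mul1r.
have kn : (k < n.+1 + 3)%N by lia.
rewrite (bigD1 (Ordinal kn))//= -[leLHS]addr0; apply: lerD; last first.
  by apply: sumr_ge0 => j _; apply: mulr_ge0.
by apply: ler_wpM2l => //; apply: h_mono; lia.
Qed.

End HarmonicFunction.

Lemma block_survival_cvg0 u :
  (exists J, 0 < \sum_(k < 3 + J) (k%:R - 3) * p k) \/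
  (forall e, 0 < e -> exists J, - e < \sum_(k < 3 + J) (k%:R - 3) * p k) /\
    (exists2 k, (k < 3)%N & 0 < p k) ->
  block_survival n u @[n --> \oo] --> 0.
Proof.
move=> drift.
pose h v : R := limn (fun n => block_survival n v).
have bcvg v : block_survival n v @[n --> \oo] --> h v := @block_survival_cvg v.
suff <- : h u = 0 by [].
apply: harmonic_eq0 drift u.
- by rewrite /h (_ : (fun _ => _) = cst 0) ?lim_cst//; apply/funext => n;
    rewrite block_survival_at0.
- move=> v w vw; apply: ler_lim; [exact: bcvg..|].
  by apply: nearW => n; exact: block_survival_nondecreasing.
(* The limit is harmonic: [block_step] at a fixed point is a finite sum, hence commutes with
   pointwise limits. *)
- move=> v; have := bcvg v; rewrite -cvg_shiftS => /cvg_unique; apply.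
    exact: Rhausdorff.
  apply: cvgM; first exact: cvg_cst.
  apply: cvg_big; first exact: add_continuous.
  by move=> k _; apply: cvgM; [exact: cvg_cst|exact: bcvg].
- move=> v; apply: limr_le; first exact: bcvg.
  apply: nearW => n; apply: le_trans (_ : block_survival 0 v <= 1).
    exact: block_survival_nonincreasing.
  by rewrite /block_survival/=; case: (_ < _)%N.
Qed.

End Survival.

(** * Natural-number-valued random variables *)

Section NatValued.
Context d (T : measurableType d) (R : realType) (P : probability T R).

(** All subsets may be allowed because [nat] carries the discrete sigma-algebra. *)
Definition nat_measurable (X : T -> nat) :=
  forall A : set nat, measurable (X @^-1` A).

Lemma nat_measurable_RV (X : {RV P >-> nat}) : nat_measurable X.
Proof. by move=> A; rewrite -[X in measurable X]setTI; exact: measurable_funPT. Qed.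

Lemma nat_measurable2 (X Y : T -> nat) (Q : nat -> nat -> Prop) :
  nat_measurable X -> nat_measurable Y -> measurable [set w | Q (X w) (Y w)].
Proof.
move=> mX mY.
rewrite (_ : [set w | _] = \bigcup_k (X @^-1` [set k] `&` Y @^-1` [set y | Q k y])).
  by apply: bigcupT_measurable => k; apply: measurableI; [exact: mX|exact: mY].
by apply/seteqP; split => [w Qw|w [k _ [/= <-]]]//; exists (X w).
Qed.

Lemma nat_measurableD (X Y : T -> nat) :
  nat_measurable X -> nat_measurable Y -> nat_measurable (fun w => X w + Y w)%N.
Proof. by move=> mX mY A; exact: (nat_measurable2 (fun x y => A (x + y)%N)). Qed.

Lemma nat_measurable_sum (X : nat -> T -> nat) m n :
  (forall i, nat_measurable (X i)) ->
  nat_measurable (fun w => \sum_(m <= i < n) X i w)%N.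
Proof.
move=> mX; elim: n => [|n IH] A.
  rewrite (_ : _ @^-1` _ = [set _ | A 0%N]); last first.
    by apply/seteqP; split=> w /=; rewrite big_geq.
  exact: (nat_measurable2 (fun _ _ => A 0%N) (mX 0) (mX 0)).
have [mn|nm] := leqP m n.
  rewrite (_ : _ @^-1` _ = [set w | A (\sum_(m <= i < n) X i w + X n w)%N]).
    exact: nat_measurableD.
  by apply/seteqP; split=> w /=; rewrite big_nat_recr.
rewrite (_ : _ @^-1` _ = [set _ | A 0%N]).
  exact: (nat_measurable2 (fun _ _ => A 0%N) (mX 0) (mX 0)).
by apply/seteqP; split=> w /=; rewrite big_geq.
Qed.

(** Real-valued probabilities make ring and linear arithmetic available. *)
Definition prob (A : set T) : R := fine (P A).

Lemma probE A : measurable A -> (prob A)%:E = P A.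
Proof. by move=> mA; rewrite fineK// fin_num_measure. Qed.

Lemma prob_ge0 A : 0 <= prob A.
Proof. exact: fine_ge0. Qed.

Lemma prob_le A B : measurable A -> measurable B -> A `<=` B ->
  prob A <= prob B.
Proof.
by move=> mA mB AB; rewrite -lee_fin !probE// le_measure ?inE.
Qed.

Lemma prob_le1 A : measurable A -> prob A <= 1.
Proof. by move=> mA; rewrite -lee_fin probE// probability_le1. Qed.

Lemma prob0 : prob set0 = 0.
Proof. by rewrite /prob measure0. Qed.

Lemma probC A : measurable A -> prob (~` A) = 1 - prob A.
Proof.
move=> mA; apply: EFin_inj.
by rewrite EFinB !probE ?probability_setC//; exact: measurableC.
Qed.

Lemma integral_prob_cst (r : R) : (\int[P]_w r%:E = r%:E)%E.
Proof.
rewrite integral_cst// [X in (_ * X)%E](_ : _ = 1%E) ?mule1//.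
exact: probability_setT.
Qed.

Lemma prob_split (X : T -> nat) A N : nat_measurable X -> measurable A ->
  (forall w, A w -> (X w < N)%N) ->
  prob A = \sum_(k < N) prob (A `&` X @^-1` [set (k : nat)]).
Proof.
move=> mX mA AN; apply: EFin_inj; rewrite probE// -sumEFin.
have mAX (k : 'I_N) : measurable (A `&` X @^-1` [set (k : nat)]).
  by apply: measurableI => //; exact: mX.
under eq_bigr do rewrite probE//.
rewrite -measure_bigsetU_ord//; last first.
  by move=> i j _ _ [w [[_ /= wi] [_ /= wj]]]; apply: val_inj; exact: (etrans (esym wi) wj).
congr (P _); rewrite -(bigcup_mkord N (fun k => A `&` X @^-1` [set k])).
apply/seteqP; split => w.
  by move=> Aw; exists (X w) => //=; exact: AN.
by case=> k _ [].
Qed.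

Lemma prob_split3 (X Y V : T -> nat) A N :
  nat_measurable X -> nat_measurable Y -> nat_measurable V -> measurable A ->
  (forall w, A w -> (X w + Y w + V w < N)%N) ->
  prob A = \sum_(i < N) \sum_(j < N) \sum_(k < N)
    prob (A `&` (X @^-1` [set (i : nat)] `&` Y @^-1` [set (j : nat)] `&`
          V @^-1` [set (k : nat)])).
Proof.
move=> mX mY mV mA AN.
rewrite (prob_split (N := N) mX mA) => [|w /AN]; last by lia.
apply: eq_bigr => i _.
have mAX : measurable (A `&` X @^-1` [set (i : nat)]).
  by apply: measurableI => //; exact: mX.
rewrite (prob_split (N := N) mY mAX) => [|w [/AN ? _]]; last by lia.
apply: eq_bigr => j _.
have mAY : measurable (A `&` X @^-1` [set (i : nat)] `&` Y @^-1` [set (j : nat)]).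
  by apply: measurableI => //; exact: mY.
rewrite (prob_split (N := N) mV mAY) => [|w [[/AN ? _] _]]; last by lia.
by apply: eq_bigr => k _; rewrite !setIA.
Qed.

(** * Expectations as series over the values of a variable *)

Section Series.
Variables (X : T -> nat) (f : nat -> R).
Hypothesis mX : nat_measurable X.
Hypothesis f_ge0 : forall k, 0 <= f k.

Lemma integral_nat_series :
  (\int[P]_w (f (X w))%:E = \sum_(k <oo) (f k * prob (X @^-1` [set k]))%:E)%E.
Proof.
have mXk k : measurable (X @^-1` [set k]) by exact: mX.
have -> : [set: T] = \bigcup_k X @^-1` [set k].
  by apply/seteqP; split=> // w _; exists (X w).
rewrite ge0_integral_bigcup//.
- apply: eq_eseriesr => k _.
  rewrite (eq_integral (fun=> (f k)%:E)); first by rewrite integral_cst// EFinM probE.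
  by move=> w; rewrite inE /= => ->.
- by move=> _ B mB; apply: measurableI; [exact: bigcupT_measurable|exact: (mX (fun k => B (f k)%:E))].
- by move=> w _; rewrite lee_fin.
- by move=> i j _ _ [w [/= <- <-]].
Qed.

Lemma partial_sum_le_integral n :
  ((\sum_(0 <= k < n) f k * prob (X @^-1` [set k]))%:E <= \int[P]_w (f (X w))%:E)%E.
Proof.
rewrite integral_nat_series -sumEFin.
apply: nneseries_lim_ge => k _ _.
by rewrite lee_fin mulr_ge0// prob_ge0.
Qed.

(** If every partial sum were at most [r], so would be the limit of the series. The integral may be
    infinite, so this also yields finite truncations of an infinite mean. *)
Lemma lt_integral_partial_sum (r : R) : (r%:E < \int[P]_w (f (X w))%:E)%E ->
  exists n, r < \sum_(0 <= k < n) f k * prob (X @^-1` [set k]).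
Proof.
rewrite integral_nat_series => rI; apply: contrapT => /forallNP small.
move: rI; rewrite ltNge => /negP; apply.
apply: lime_le.
  by apply: is_cvg_nneseries => k _; rewrite lee_fin mulr_ge0// prob_ge0.
apply: nearW => n; rewrite sumEFin lee_fin leNgt; exact/negP.
Qed.

End Series.
End NatValued.

(** * The seasonal model *)

Section Model.
Context (d : measure_display) (T : measurableType d) (R : realType)
  (P : probability T R) (Z : nat -> {RV P >-> nat}) (hZ : three_seasonal Z).

Let mZ i : nat_measurable (Z i). Proof. exact: nat_measurable_RV. Qed.

Lemma claims_product_rule (n : nat) (A : nat -> set nat) :
  prob P (\bigcap_(i < n) (Z i.+1 @^-1` A i)) =
  \prod_(i < n) prob P (Z i.+1 @^-1` A i).
Proof.
pose J := [fset x in iota 1 n]%fset.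
have memJ x : (x \in J) = (1 <= x < n.+1)%N by rewrite !inE mem_iota add1n.
(* Claims are numbered from 1 but the sets from 0, hence the predecessor. *)
have /(_ J (fun i => A i.-1)) := claims_independent hZ.
have JD : [set` J] `<=` [set m | (0 < m)%N].
  by move=> m /=; rewrite memJ => /andP[].
move=> /(_ JD (fun _ => I)).
rewrite (perm_big (iota 1 n))/=; last first.
  by apply: uniq_perm; rewrite ?fset_uniq ?iota_uniq// => x; rewrite memJ mem_iota.
rewrite (_ : \bigcap_(i in _) _ = \bigcap_(i < n) (Z i.+1 @^-1` A i)); last first.
  apply/seteqP; split=> [w Jw i /= ni|w Jw [|i] /=]; rewrite ?memJ//.
    by apply: (Jw i.+1) => /=; rewrite memJ.
  by move=> ni; exact: Jw.
rewrite -(probE P); last first.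
  by apply: fin_bigcap_measurable => [|i _]; [exact: finite_II|exact: mZ].
move=> PJ; apply: EFin_inj; rewrite PJ.
rewrite -prodEFin -(big_mkord xpredT (fun i => (prob P (Z i.+1 @^-1` A i))%:E)).
rewrite -(big_add1 _ _ 0 n.+1 xpredT (fun i => (prob P (Z i @^-1` A i.-1))%:E)).
rewrite /index_iota subSS subn0; apply: eq_bigr => i _.
by rewrite probE//; exact: mZ.
Qed.

Let season1 m A : prob P (Z (3 * m).+1 @^-1` A) = prob P (Z 1 @^-1` A).
Proof. by rewrite -addn1 /prob; congr fine; exact: (claims_season1 hZ). Qed.

Let season2 m A : prob P (Z (3 * m).+2 @^-1` A) = prob P (Z 2 @^-1` A).
Proof. by rewrite -addn2 /prob; congr fine; exact: (claims_season2 hZ). Qed.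

Let season3 m A : prob P (Z (3 * m).+3 @^-1` A) = prob P (Z 3 @^-1` A).
Proof. by rewrite -addn3 /prob; congr fine; exact: (claims_season3 hZ). Qed.

(** * Law of the claim of one block *)

Local Notation a A := (prob P (Z 1 @^-1` A)).
Local Notation b A := (prob P (Z 2 @^-1` A)).
Local Notation c A := (prob P (Z 3 @^-1` A)).

Lemma block_product_rule A B C :
  prob P (Z 1 @^-1` A `&` Z 2 @^-1` B `&` Z 3 @^-1` C) = a A * b B * c C.
Proof.
have := claims_product_rule 3 (fun i => nth setT [:: A; B; C] i).
rewrite !big_ord_recr big_ord0/= mul1r => <-; congr prob.
apply/seteqP; split => [w [[wA wB] wC] [|[|[|i]]]//|w Aw].
by split; [split|]; [exact: (Aw 0)|exact: (Aw 1)|exact: (Aw 2)].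
Qed.

Definition block_claim : T -> nat := fun w => (Z 1 w + Z 2 w + Z 3 w)%N.

Lemma nat_measurable_block_claim : nat_measurable block_claim.
Proof. by apply: nat_measurableD => //; exact: nat_measurableD. Qed.

Definition block_pmf k := prob P (block_claim @^-1` [set k]).

Local Notation p := block_pmf.

Let p_ge0 k : 0 <= p k. Proof. exact: prob_ge0. Qed.

Let block_law N k : (k < N)%N ->
  p k = \sum_(k1 < N) \sum_(k2 < N) \sum_(k3 < N)
    (k1 + k2 + k3 == k)%N%:R * (a [set (k1 : nat)] * b [set (k2 : nat)] * c [set (k3 : nat)]).
Proof.
move=> kN; rewrite /block_pmf (prob_split3 P (N := N) (mZ 1) (mZ 2) (mZ 3)).
- apply: eq_bigr => k1 _; apply: eq_bigr => k2 _; apply: eq_bigr => k3 _.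
  have [sk|sk] := eqVneq.
    rewrite mul1r -block_product_rule; congr prob; apply/seteqP; split => [w []//|w].
    by move=> [[/= w1 w2] w3]; split => //=; rewrite /block_claim w1 w2 w3.
  rewrite mul0r (_ : _ `&` _ = set0) ?prob0// -subset0 => w [/= wk [[w1 w2] w3]].
  by move/eqP: sk; apply; rewrite -wk /block_claim w1 w2 w3.
- exact: nat_measurable_block_claim.
- by move=> w /= wk; rewrite -/(block_claim w) wk.
Qed.

(** Grouping triples by their sum gives the block law; triples with sum at least [N] disappear
    because the truncated argument is 0 and [g 0 = 0]. *)
Let block_convolution N (g : nat -> R) : g 0 = 0 ->
  \sum_(k1 < N) \sum_(k2 < N) \sum_(k3 < N)
    (a [set (k1 : nat)] * b [set (k2 : nat)] * c [set (k3 : nat)]) *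
      g (N - (k1 + k2 + k3))%N =
  \sum_(k < N) p k * g (N - k)%N.
Proof.
move=> g0.
transitivity (\sum_(k < N) \sum_(k1 < N) \sum_(k2 < N) \sum_(k3 < N)
   (k1 + k2 + k3 == k)%N%:R * (a [set (k1 : nat)] * b [set (k2 : nat)] * c [set (k3 : nat)])
     * g (N - k)%N); last first.
  apply: eq_bigr => k _; rewrite (@block_law N)// mulr_suml; apply: eq_bigr => k1 _.
  by rewrite mulr_suml; apply: eq_bigr => k2 _; rewrite mulr_suml.
rewrite [RHS]exchange_big; apply: eq_bigr => k1 _ /=.
rewrite [RHS]exchange_big; apply: eq_bigr => k2 _ /=.
rewrite [RHS]exchange_big; apply: eq_bigr => k3 _ /=.
have [sN|Ns] := ltnP (k1 + k2 + k3) N.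
  rewrite (bigD1 (Ordinal sN))//= eqxx mul1r big1 ?addr0// => k.
  by rewrite -val_eqE/= eq_sym => /negbTE ->; rewrite !mul0r.
rewrite (_ : (N - _)%N = 0%N) ?g0 ?mulr0; last by apply/eqP.
rewrite big1// => k _; rewrite (_ : (_ == _ :> nat) = false) ?mul0r//.
by apply/negbTE; rewrite neq_ltn orbC (leq_trans (ltn_ord k)).
Qed.

(** * Comparison of the claim process with the killed block walk *)

Let prefix n (z : nat -> nat) := \bigcap_(i < n) (Z i.+1 @^-1` [set z i]).

(** A history of [m] blocks followed by the three claims of the next block. *)
Let extend m (z : nat -> nat) k1 k2 k3 i :=
  if (i < 3 * m)%N then z i else nth 0%N [:: k1; k2; k3] (i - 3 * m).

Let prefix_measurable n z : measurable (prefix n z).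
Proof.
by apply: fin_bigcap_measurable => [|i _]; [exact: finite_II|exact: mZ].
Qed.

Let prefix_extend m z k1 k2 k3 :
  prob P (prefix (3 * m.+1) (extend m z k1 k2 k3)) =
  prob P (prefix (3 * m) z) * (a [set k1] * b [set k2] * c [set k3]).
Proof.
have e0 : extend m z k1 k2 k3 (3 * m) = k1 by rewrite /extend ltnn subnn.
have e1 : extend m z k1 k2 k3 (3 * m).+1 = k2.
  by rewrite /extend ifN ?subSn ?subnn//; lia.
have e2 : extend m z k1 k2 k3 (3 * m).+2 = k3.
  have d2 : ((3 * m).+2 - 3 * m = 2)%N by lia.
  by rewrite /extend ifN ?d2//; lia.
rewrite !claims_product_rule mulnSr addn3 !big_ord_recr/= e0 e1 e2.
rewrite season1 season2 season3.
rewrite -!mulrA; congr (_ * _); apply: eq_bigr => i _.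
by rewrite /extend ltn_ord.
Qed.

Let claim_sum m n w := (\sum_(m <= i < n) Z i.+1 w)%N.

(** Survival at the ends of the [n] blocks following time [3 * m], when the surplus at that time is
    [u]. *)
Let stay m n u := [set w | forall j, (1 <= j <= n)%N ->
  (claim_sum (3 * m) (3 * (m + j)) w < u + 3 * j)%N].

Let stay_measurable m n u : measurable (stay m n u).
Proof.
rewrite (_ : stay m n u = \bigcap_j (claim_sum (3 * m) (3 * (m + j)) @^-1`
    [set s | (1 <= j <= n)%N -> (s < u + 3 * j)%N])).
  by apply: bigcapT_measurable => j; exact: (@nat_measurable_sum _ _ (fun i => Z i.+1)).
by apply/seteqP; split => [w ws j _ /=|w ws j]; [exact: ws|exact: (ws j I)].
Qed.

(** An elementary Markov property: conditioning on a history is replaced by intersecting with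
    [prefix]. The history and the surplus vary in the induction, since treating the first block
    lengthens the one and changes the other. *)
Let stay_prefix_le n : forall m z u, (0 < u)%N ->
  prob P (prefix (3 * m) z `&` stay m n u) <=
  prob P (prefix (3 * m) z) * block_survival p n u.
Proof.
elim: n => [|n IH] m z u u0.
  rewrite /block_survival/= u0 mulr1; apply: prob_le => //.
  exact: measurableI.
set A := _ `&` _; set N := (u + 3)%N.
have mA : measurable A by exact: measurableI.
have blockE w : claim_sum (3 * m) (3 * (m + 1)) w =
    (Z (3 * m).+1 w + Z (3 * m).+2 w + Z (3 * m).+3 w)%N.
  by rewrite /claim_sum mulnDr muln1 addn3 !big_nat_recr ?big_geq//=; lia.
have AN w : A w -> (Z (3 * m).+1 w + Z (3 * m).+2 w + Z (3 * m).+3 w < N)%N.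
  by rewrite -blockE => -[_ /(_ 1%N isT)]; rewrite muln1.
(* Surviving the first block forces its three claims to sum to less than [u + 3], so finitely many
   triples suffice. *)
have -> : prob P A = \sum_(k1 < N) \sum_(k2 < N) \sum_(k3 < N)
    prob P (A `&` (Z (3 * m).+1 @^-1` [set (k1 : nat)] `&`
      Z (3 * m).+2 @^-1` [set (k2 : nat)] `&` Z (3 * m).+3 @^-1` [set (k3 : nat)])).
  apply: prob_split3 => // w; exact: AN.
rewrite /block_survival iterS -/(block_survival _ _) /block_step u0 mul1r -/N.
rewrite -(block_convolution _ (block_survival_at0 _ _)) mulr_sumr.
apply: ler_sum => k1 _; rewrite mulr_sumr; apply: ler_sum => k2 _.
rewrite mulr_sumr; apply: ler_sum => k3 _.
rewrite mulrA -prefix_extend.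
have mB : measurable (A `&` (Z (3 * m).+1 @^-1` [set (k1 : nat)] `&`
      Z (3 * m).+2 @^-1` [set (k2 : nat)] `&` Z (3 * m).+3 @^-1` [set (k3 : nat)])).
  by apply: measurableI => //; apply: measurableI; [apply: measurableI|]; exact: mZ.
have [sN|Ns] := ltnP (k1 + k2 + k3) N; last first.
  rewrite (_ : _ `&` _ = set0).
    by rewrite prob0 mulr_ge0 ?prob_ge0//; exact: block_survival_ge0.
  rewrite -subset0 => w [/AN + [[/= w1 w2] w3]].
  by rewrite w1 w2 w3 ltnNge Ns.
(* The process restarts after block [m.+1] with the positive surplus [u + 3 - (k1 + k2 + k3)]. *)
apply: le_trans (IH m.+1 _ (N - (k1 + k2 + k3))%N _); last by rewrite subn_gt0.
apply: prob_le => //; first exact: measurableI.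
move=> w [[wpre wstay] [[/= w1 w2] w3]]; split.
  move=> i /= im; rewrite /extend; have [ilt|ile] := ltnP i (3 * m); first exact: wpre.
  have [->|[->|->]] : i = (3 * m)%N \/ i = (3 * m).+1 \/ i = (3 * m).+2 by lia.
  - by rewrite subnn.
  - by rewrite subSnn.
  - by rewrite (_ : ((3 * m).+2 - 3 * m = 2)%N)//; lia.
move=> j jn; have /wstay : (1 <= j.+1 <= n.+1)%N by lia.
rewrite addnS /claim_sum (@big_cat_nat _ _ _ (3 * m.+1))/=; [|lia|lia].
rewrite -{1}(addn1 m) -/(claim_sum _ _ _) blockE w1 w2 w3 -/(claim_sum _ _ _).
lia.
Qed.

Let p_le1 n : \sum_(k < n) p k <= 1.
Proof.
rewrite -lee_fin.
have := partial_sum_le_integral P nat_measurable_block_claim (fun=> ler01) n.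
rewrite integral_prob_cst big_mkord.
by under eq_bigr do rewrite mul1r.
Qed.

Definition ruin u := \bigcup_(n in [set n | (1 <= n)%N]) [set w | surplus Z u n w <= 0].

Let surplus_le0 u n w : (surplus Z u n w <= 0) = (u + n <= claim_sum 0 n w)%N.
Proof.
rewrite /surplus /claim_sum subr_le0 big_add1/= -(big_morph Posz PoszD (erefl _)).
by rewrite -PoszD lez_nat.
Qed.

Lemma ruin_measurable u : measurable (ruin u).
Proof.
apply: bigcup_measurable => n _.
rewrite (_ : [set w | _] = claim_sum 0 n @^-1` [set s | (u + n <= s)%N]).
  exact: (@nat_measurable_sum _ _ (fun i => Z i.+1)).
by apply/seteqP; split=> w /=; rewrite surplus_le0.
Qed.

(** Never being ruined implies survival at the first [n] block ends, for every [n], so its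
    probability is at most each [block_survival p n u]. *)
Let prob_ruin_eq1_pos u : (0 < u)%N -> block_survival p n u @[n --> \oo] --> 0 ->
  prob P (ruin u) = 1.
Proof.
move=> u0 bs0.
suff : prob P (~` ruin u) <= 0.
  rewrite probC; last exact: ruin_measurable.
  by rewrite subr_le0 => r1; apply/eqP; rewrite eq_le r1 prob_le1//; exact: ruin_measurable.
apply: (cvgr_to_ge bs0); apply: nearW => n.
have := @stay_prefix_le n 0 (fun=> 0%N) u u0.
rewrite (_ : prefix _ _ = setT) ?setTI /prob ?probability_setT/= ?mul1r; last first.
  by rewrite /prefix muln0 II0 bigcap_set0.
apply: le_trans; apply: prob_le; [|exact: stay_measurable|].
  by apply: measurableC; exact: ruin_measurable.
move=> w nruin j /andP[j1 _]; rewrite ltnNge add0n muln0; apply/negP => jr.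
by apply: nruin; exists (3 * j)%N => /=; [lia|rewrite surplus_le0].
Qed.

Lemma prob_ruin_eq1 u :
  (exists J, 0 < \sum_(k < 3 + J) (k%:R - 3) * p k) \/
  (forall e, 0 < e -> exists J, - e < \sum_(k < 3 + J) (k%:R - 3) * p k) /\
    (exists2 k, (k < 3)%N & 0 < p k) ->
  prob P (ruin u) = 1.
Proof.
move=> drift.
have ruin_pos v : (0 < v)%N -> prob P (ruin v) = 1.
  by move=> v0; apply: prob_ruin_eq1_pos => //; exact: block_survival_cvg0.
(* The killed walk says nothing about a start at 0, since ruin is only tested from time 1 on; this
   case follows from the inclusion of [ruin 1] in [ruin 0]. *)
case: u => [|u]; last exact: ruin_pos.
apply/eqP; rewrite eq_le prob_le1/=; last exact: ruin_measurable.
rewrite -(ruin_pos 1%N isT); apply: prob_le; [exact: ruin_measurable..|].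
move=> w [n n1 /=]; rewrite surplus_le0 => ?; exists n => //=.
by rewrite surplus_le0; lia.
Qed.

(** * From the mean block claim to truncated drifts *)

Local Notation ES := ('E_P[fun w => (block_claim w)%:R])%E.

Let meanE : ES = (\int[P]_w ((block_claim w)%:R)%:E)%E.
Proof. by rewrite unlock. Qed.

Let lt_mean_partial_sum r : (r%:E < ES)%E ->
  exists J, r < \sum_(k < 3 + J) k%:R * p k.
Proof.
rewrite meanE => /(lt_integral_partial_sum nat_measurable_block_claim
  (fun k => ler0n R k))[n].
rewrite big_mkord => rn; exists n; apply: (lt_le_trans rn).
rewrite (sum_ord_split (fun k => k%:R * p k) (leq_addl 3 n)) lerDl.
by apply: sumr_ge0 => k _; apply: mulr_ge0.
Qed.

Let drift_sumE n : \sum_(k < n) (k%:R - 3) * p k =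
  \sum_(k < n) k%:R * p k - 3 * \sum_(k < n) p k.
Proof. by rewrite mulr_sumr -sumrB; apply: eq_bigr => k _; rewrite mulrBl. Qed.

Lemma prob_ruin_eq1_supercritical u : (3%:E < ES)%E -> prob P (ruin u) = 1.
Proof.
move=> /lt_mean_partial_sum[J MJ]; apply: prob_ruin_eq1; left; exists J.
by rewrite drift_sumE; have := p_le1 (3 + J); lra.
Qed.

Let mass_partial_sum e : 0 < e -> exists n, 1 - e < \sum_(k < n) p k.
Proof.
move=> e0.
have /(lt_integral_partial_sum nat_measurable_block_claim (fun=> ler01))[n] :
    ((1 - e)%:E < \int[P]_w ((fun=> 1 : R) (block_claim w))%:E)%E.
  by rewrite integral_prob_cst lte_fin; lra.
by rewrite big_mkord => ?; exists n; under eq_bigr do rewrite -[p _]mul1r.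
Qed.

(** A variable that is almost surely at least its mean equals it almost surely. Here all drift terms
    are nonnegative, so mass above 3 would make the drift positive. *)
Let critical_block_mass : ES = 3%:E -> (forall k, (k < 3)%N -> p k = 0) -> 1 <= p 3.
Proof.
move=> ES3 p012.
have term_ge0 k : 0 <= (k%:R - 3) * p k.
  have [k3|k3] := ltnP k 3; first by rewrite p012// mulr0.
  by apply: mulr_ge0 => //; rewrite subr_ge0 ler_nat.
have p_gt3 j : (3 < j)%N -> p j = 0.
  move=> j3; apply/eqP; rewrite eq_le p_ge0 andbT leNgt; apply/negP => pj.
  (* With truncated mean at most 3 and mass above [1 - p j / 3], the drift is below [p j]; yet its
     term at [j > 3] alone is at least [p j]. *)
  have [|n qn] := @mass_partial_sum (p j / 3); first exact: divr_gt0.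
  have jN : (j < n + j.+1)%N by lia.
  have mN : \sum_(k < n + j.+1) k%:R * p k <= 3.
    rewrite -lee_fin -ES3 meanE -(big_mkord xpredT (fun k => k%:R * p k)).
    exact: partial_sum_le_integral nat_measurable_block_claim (fun k => ler0n R k) _.
  have qN : \sum_(k < n) p k <= \sum_(k < n + j.+1) p k.
    by rewrite (sum_ord_split p (leq_addr j.+1 n)) lerDl; exact: sumr_ge0.
  have : p j <= \sum_(k < n + j.+1) (k%:R - 3) * p k.
    rewrite (bigD1 (Ordinal jN))//= -[leLHS]addr0; apply: lerD; last exact: sumr_ge0.
    rewrite -[leLHS]mul1r; apply: ler_wpM2r => //.
    by have : 4 <= j%:R :> R; [rewrite ler_nat | lra].
  by rewrite drift_sumE; lra.
apply/ler_addgt0Pr => e e0; have [n qn] := mass_partial_sum e0.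
suff : \sum_(k < n) p k <= p 3 by lra.
have n3 : (3 < n + 4)%N by lia.
apply: (@le_trans _ _ (\sum_(k < n + 4) p k)).
  by rewrite (sum_ord_split p (leq_addr 4 n)) lerDl; exact: sumr_ge0.
rewrite (bigD1 (Ordinal n3))//= big1 ?addr0// => k.
rewrite -val_eqE neq_ltn/= => /orP[]; [exact: p012|exact: p_gt3].
Qed.

Lemma prob_ruin_eq1_critical u : ES = 3%:E -> p 3 < 1 -> prob P (ruin u) = 1.
Proof.
move=> ES3 p3; apply: prob_ruin_eq1; right; split.
  move=> e e0; have [|J MJ] := @lt_mean_partial_sum (3 - e).
    by rewrite ES3 lte_fin; lra.
  by exists J; rewrite drift_sumE; have := p_le1 (3 + J); lra.
(* If no value below 3 had positive mass, [critical_block_mass] would contradict [p 3 < 1]. *)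
apply: contrapT => nok; move: p3; rewrite ltNge => /negP; apply.
apply: critical_block_mass => // k k3.
apply/eqP; rewrite eq_le p_ge0 andbT leNgt; apply/negP => pk.
by apply: nok; exists k.
Qed.

(** * Constant claims *)

Section Deterministic.
Variables i j k : nat.
Hypothesis ijk : (i + j + k = 3)%N.
Hypotheses (ai : a [set i] = 1) (bj : b [set j] = 1) (ck : c [set k] = 1).

(** Indexed from 0: [const n] is the value of claim [n.+1]. *)
Let const n := nth 0%N [:: i; j; k] (n %% 3).

Let sum_const m r : (r < 3)%N ->
  (\sum_(0 <= t < 3 * m + r) const t = 3 * m + nth 0%N [:: 0; i; i + j] r)%N.
Proof.
have const3 q s : const (3 * q + s) = const s by rewrite /const mulnC modnMDl.
have sum3 : (\sum_(0 <= t < 3 * m) const t = 3 * m)%N.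
  elim: m => [|m IH]; first by rewrite big_geq.
  rewrite mulnS addnC addn3 !big_nat_recr//= IH -[(3 * m)%N]addn0 -!addnS !const3.
  by rewrite /const/=; lia.
case: r => [|[|[|]]]// _; rewrite ?addn0 ?addn1 ?addn2 ?big_nat_recr//= sum3//.
  by rewrite -[X in const X]addn0 const3.
by rewrite -[X in const X]addn0 -(addn1 (3 * m)) !const3 /const/=; lia.
Qed.

Let path := \bigcap_n (Z n.+1 @^-1` [set const n]).

Let path_measurable : measurable path.
Proof. by apply: bigcapT_measurable => n; exact: mZ. Qed.

(** The complement is a countable union of null events, one for each claim. *)
Let prob_path : prob P path = 1.
Proof.
suff : prob P (~` path) = 0 by rewrite probC//; lra.
have neg : P.-negligible (\bigcup_n ~` (Z n.+1 @^-1` [set const n])); last first.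
  rewrite /prob /path setC_bigcap; move/negligibleP: neg => -> //.
  by apply: bigcupT_measurable => n; apply: measurableC; exact: mZ.
apply: negligible_bigcup => n.
have mn : measurable (Z n.+1 @^-1` [set const n]) by exact: mZ.
apply/negligibleP; first exact: measurableC.
apply: etrans (esym (probE P (measurableC mn))) _.
rewrite probC//; suff -> : prob P (Z n.+1 @^-1` [set const n]) = 1 by rewrite subrr.
rewrite /const {1}(divn_eq n 3) mulnC; have := ltn_pmod n (isT : (0 < 3)%N).
case: (n %% 3)%N => [|[|[|]]]// _; rewrite ?addn0 ?addn1 ?addn2/=.
- by rewrite season1.
- by rewrite season2.
- by rewrite season3.
Qed.

Let claim_sum_path w n : path w -> claim_sum 0 n w = (\sum_(0 <= t < n) const t)%N.
Proof. by move=> wp; apply: eq_bigr => t _; exact: (wp t I). Qed.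

(** On [path] the surplus is periodic, with values [u + 1 - i], [u + 2 - (i + j)] and [u] at times
    1, 2 and 3; ruin happens by time 3 or never. *)
Lemma prob_ruin_deterministic u :
  prob P (ruin u) = [|| (u < i)%N, (u.+1 < i + j)%N | u == 0%N]%:R.
Proof.
have mr := ruin_measurable u.
have [cond|cond] := boolP [|| _, _ | _].
  apply/eqP; rewrite eq_le prob_le1//= -prob_path; apply: prob_le => // w wp.
  suff [n [n1 un]] : exists n, (1 <= n)%N /\ (u + n <= claim_sum 0 n w)%N.
    by exists n => //=; rewrite surplus_le0.
  have [u1|[u1|u1]] : (u < i)%N \/ (u.+1 < i + j)%N \/ u = 0%N.
    by case/or3P: cond => [|| /eqP]; tauto.
  - by exists 1%N; rewrite claim_sum_path// (@sum_const 0 1)//=; lia.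
  - by exists 2; rewrite claim_sum_path// (@sum_const 0 2)//=; lia.
  - by exists 3; rewrite claim_sum_path// (@sum_const 1 0)//=; lia.
apply/eqP; rewrite eq_le prob_ge0 andbT mulr0n.
have <- : prob P (~` path) = 0 by rewrite probC// prob_path subrr.
apply: prob_le => //; first exact: measurableC.
move=> w [n n1 /=]; rewrite surplus_le0 => un wp; move: un.
rewrite claim_sum_path// (divn_eq n 3) mulnC sum_const ?ltn_mod//.
have n1' : (1 <= 3 * (n %/ 3) + n %% 3)%N by rewrite mulnC -divn_eq.
move: n1' (ltn_pmod n (isT : (0 < 3)%N)) cond.
case: (n %% 3)%N => [|[|[|]]]//=; lia.
Qed.

End Deterministic.

(** Take values [i], [j], [k] of positive joint probability; they sum to 3. Changing exactly one of
    them changes the sum, so the complement of each value is null by the product rule. *)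
Lemma deterministic_block : p 3 = 1 ->
  exists i j k, [/\ (i + j + k = 3)%N, a [set i] = 1, b [set j] = 1 & c [set k] = 1].
Proof.
move=> p3.
have mp n : measurable (block_claim @^-1` [set n]) by exact: nat_measurable_block_claim.
(* Such a product event lies in the complement of [block_claim = 3], which is null. *)
have off A B C : (forall x y z, A x -> B y -> C z -> (x + y + z != 3)%N) ->
    a A * b B * c C = 0.
  move=> ABC; rewrite -block_product_rule; apply/eqP.
  rewrite eq_le prob_ge0 andbT (_ : 0 = 1 - p 3); last by rewrite p3 subrr.
  rewrite -probC//; apply: prob_le; last first.
  - by move=> w [[Aw Bw] Cw] /eqP; apply/negP; exact: ABC.
  - exact: measurableC.
  - by apply: measurableI; [apply: measurableI|]; exact: mZ.
have [[i [j [k abc]]]|none] :=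
    pselect (exists i j k, a [set i] * b [set j] * c [set k] != 0); last first.
  (* If all the products vanished, the convolution formula would give [p 3 = 0]. *)
  move: p3; rewrite (@block_law 4)// !big1 => [/esym/eqP|x _]; first by rewrite oner_eq0.
  rewrite big1// => y _; rewrite big1// => z _; apply/eqP.
  rewrite mulf_eq0; apply/orP; right; apply: contrapT => /negP xyz.
  by apply: none; exists (x : nat), (y : nat), (z : nat).
have ijk : (i + j + k = 3)%N.
  apply: contrapT => /eqP ijk; move/eqP: abc; apply; apply: off.
  by move=> _ _ _ -> -> ->.
have := abc; rewrite !mulf_eq0 !negb_or => /andP[/andP[a0 b0] c0].
have eq1 (X : nat) n : prob P (~` (Z X @^-1` [set n])) = 0 -> prob P (Z X @^-1` [set n]) = 1.
  by rewrite probC; [lra|exact: mZ].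
exists i, j, k; split=> //; apply: eq1.
- have : a (~` [set i]) * b [set j] * c [set k] = 0.
    by apply: off => x _ _ xi -> ->; have : x <> i by []; lia.
  by move=> /eqP; rewrite !mulf_eq0 (negbTE b0) (negbTE c0) !orbF => /eqP.
- have : a [set i] * b (~` [set j]) * c [set k] = 0.
    by apply: off => _ y _ -> yj ->; have : y <> j by []; lia.
  by move=> /eqP; rewrite !mulf_eq0 (negbTE a0) (negbTE c0) !orbF => /eqP.
- have : a [set i] * b [set j] * c (~` [set k]) = 0.
    by apply: off => _ _ z -> -> zk; have : z <> k by []; lia.
  by move=> /eqP; rewrite !mulf_eq0 (negbTE a0) (negbTE b0) => /eqP.
Qed.

End Model.

(** * Classification by the mean block claim *)

Local Open Scope ereal_scope.

Theorem theorem4 (d : measure_display) (T : measurableType d) (R : realType)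
    (P : probability T R) (Z : nat -> {RV P >-> nat})
    (hZ : three_seasonal Z) :
  let S : T -> nat := fun w => (Z 1%N w + Z 2%N w + Z 3%N w)%N in
  let ES : \bar R := 'E_P[fun w => (S w)%:R] in
  let a := local_prob P (Z 1%N) in
  let b := local_prob P (Z 2%N) in
  let c := local_prob P (Z 3%N) in
  let s := local_prob P S in
  let psi := ruin_probability P Z in
  let case1 : Prop := [/\ a 3%N = 1, b 0%N = 1 & c 0%N = 1] in
  let case2 : Prop :=
    [\/ [/\ a 0%N = 1, b 3%N = 1 & c 0%N = 1],
        [/\ a 2%N = 1, b 1%N = 1 & c 0%N = 1],
        [/\ a 1%N = 1, b 2%N = 1 & c 0%N = 1]
      | [/\ a 2%N = 1, b 0%N = 1 & c 1%N = 1]] in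
  let case3 : Prop :=
    [/\ a 0%N = 1, b 0%N = 1 & c 3%N = 1] \/
    [\/ [/\ a 0%N = 1, b 2%N = 1 & c 1%N = 1],
        [/\ a 0%N = 1, b 1%N = 1 & c 2%N = 1],
        [/\ a 1%N = 1, b 0%N = 1 & c 2%N = 1]
      | [/\ a 1%N = 1, b 1%N = 1 & c 1%N = 1]] in
  let case4 : Prop := s 3%N < 1 in
  (3%:R%:E < ES -> forall u : nat, psi u = 1) /\
  (ES = 3%:R%:E ->
    [\/ case1, case2, case3 | case4] /\
    [/\ case1 -> [/\ psi 0%N = 1, psi 1%N = 1, psi 2%N = 1
                   & forall u : nat, (3 <= u)%N -> psi u = 0],
        case2 -> [/\ psi 0%N = 1, psi 1%N = 1
                   & forall u : nat, (2 <= u)%N -> psi u = 0],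
        case3 -> psi 0%N = 1 /\ (forall u : nat, (1 <= u)%N -> psi u = 0)
      & case4 -> forall u : nat, psi u = 1]).
Proof.
move=> S ES a b c s psi case1 case2 case3 case4.
have psiE u : psi u = (prob P (ruin Z u))%:E by rewrite probE//; exact: ruin_measurable.
have mZ i A : measurable (Z i @^-1` A) by exact: nat_measurable_RV.
have aE i : a i = (prob P (Z 1 @^-1` [set i]))%:E by rewrite probE.
have bE i : b i = (prob P (Z 2 @^-1` [set i]))%:E by rewrite probE.
have cE i : c i = (prob P (Z 3 @^-1` [set i]))%:E by rewrite probE.
have sE : s 3%N = (block_pmf Z 3)%:E.
  by rewrite probE//; exact: nat_measurable_block_claim.
(* This one formula yields all three deterministic cases: ruin occurs exactly for [u] below the
   maximum of [i], [i + j - 1] and 1. *)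
have det i j k : [/\ a i = 1, b j = 1 & c k = 1] -> (i + j + k = 3)%N ->
    forall u, psi u = ([|| (u < i)%N, (u.+1 < i + j)%N | u == 0%N]%:R)%:E.
  rewrite aE bE cE => -[[ai] [bj] [ck]] ijk u.
  by rewrite psiE (prob_ruin_deterministic hZ ijk ai bj ck).
split=> [ES3 u|ES3]; first by rewrite psiE prob_ruin_eq1_supercritical.
split; [|split].
- have [s3|s3] := ltP (s 3%N) 1; first by apply: Or44.
  have /(deterministic_block hZ)[i [j [k []]]] : block_pmf Z 3 = 1%R.
    apply/eqP; rewrite eq_le prob_le1/=; last exact: nat_measurable_block_claim.
    by rewrite -lee_fin -sE.
  move=> ijk ai bj ck; have {ai bj ck}: [/\ a i = 1, b j = 1 & c k = 1].
    by rewrite aE bE cE ai bj ck.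
  rewrite /case1 /case2 /case3.
  (* Eliminating [k] leaves the ten pairs with [i + j <= 3], one for each listed configuration. *)
  have -> : k = (3 - i - j)%N by lia.
  have : (i + j <= 3)%N by lia.
  by case: i {ijk} => [|[|[|[|i]]]]; case: j => [|[|[|[|j]]]]//= _ abc;
    solve [exact: Or41 | apply: Or42; by [exact: Or41|exact: Or42|exact: Or43|exact: Or44]
      | apply: Or43; left; exact: abc
      | apply: Or43; right; by [exact: Or41|exact: Or42|exact: Or43|exact: Or44]].
- move=> /det/(_ erefl) psi3; rewrite !psi3; split=> // u u3.
  by rewrite psi3 (_ : [|| _, _ | _] = false)//; lia.
- by case=> /det/(_ erefl) psi2; rewrite !psi2; split=> // u u2;
    rewrite psi2 (_ : [|| _, _ | _] = false)//; lia.
- by case=> [|[]] /det/(_ erefl) psi1; rewrite !psi1; split=> // u u1;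
    rewrite psi1 (_ : [|| _, _ | _] = false)//; lia.
- by move=> s3 u; rewrite psiE prob_ruin_eq1_critical// -lte_fin -sE.
Qed.
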